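(* Let $k \geq 2$ be an even integer. Let $q$ be a prime power such that $q \equiv k+1 \pmod{2k}$. Then $$\mathcal{K}_4(G_k(q)) = \frac{q^3(q-1)}{k^6} \sum_{\vec{t} \in (\mathbb{Z}_{k})^{5}} {_{3}F_2}\left( \vec{t} \; \big| \; 1 \right)_{q,k}.$$
   Context: $\mathbb{F}_q$ is the finite field with $q$ elements and $S_k \subset \mathbb{F}_q^*$ is the subgroup of nonzero $k$-th powers (of order $\frac{q-1}{k}$). The $k$-th power Paley digraph $G_k(q)$ has vertex set $\mathbb{F}_q$, and $a \to b$ is an edge if and only if $b-a \in S_k$ (the condition on $q$ gives $-1 \notin S_k$, so there is at most one edge between any two vertices). For a digraph $G$, $\mathcal{K}_m(G)$ is the number of transitive subtournaments of order $m$ contained in $G$; a tournament of order $m$ is transitive if its vertices can be listed $a_1,\dots,a_m$ with $a_i \to a_j$ for all $i<j$. Every multiplicative character $\chi$ of $\mathbb{F}_q^*$ (complex-valued), including the trivial character $\varepsilon$, is extended to $\mathbb{F}_q$ by $\chi(0):=0$; $\bar{\chi}$ is the inverse of $\chi$. For characters $A,B$ define the Jacobi sum $J(A,B):=\sum_{a \in \mathbb{F}_q} A(a)B(1-a)$ and $\binom{A}{B} := \frac{B(-1)}{q} J(A,\bar{B})$. For characters $A_0,\dots,A_n,B_1,\dots,B_n$ of $\mathbb{F}_q^*$ and $\lambda\in\mathbb{F}_q$, Greene's finite field hypergeometric function is $${_{n+1}F_n}\left( \begin{array}{cccc} A_0, & A_1, & \dotsc, & A_n \\ & B_1, & \dotsc,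 & B_n \end{array} \Big| \; \lambda \right)_{q} := \frac{q}{q-1} \sum_{\chi} \binom{A_0 \chi}{\chi} \binom{A_1 \chi}{B_1 \chi} \dotsm \binom{A_n \chi}{B_n \chi} \chi(\lambda),$$ the sum being over all multiplicative characters $\chi$ of $\mathbb{F}_q^*$. Let $\chi_k$ be a fixed character of $\mathbb{F}_q^*$ of order $k$. For $\vec{t}=(t_1,t_2,t_3,t_4,t_5) \in (\mathbb{Z}_k)^5$, where $\mathbb{Z}_k=\mathbb{Z}/k\mathbb{Z}$, $${_{3}F_2}\left( \vec{t} \; \big| \; \lambda \right)_{q,k} := (-1)^{t_3+t_5}\, {_{3}F_2}\left( \begin{array}{ccc} \chi_k^{t_1}, & \chi_k^{t_2}, & \chi_k^{t_3} \\ & \chi_k^{t_4}, & \chi_k^{t_5} \end{array} \Big| \; \lambda \right)_{q}.$$ *)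

(* Defs.v *)
From HB Require Import structures.
From mathcomp Require Import all_boot all_order all_algebra all_fingroup.
From mathcomp Require Import all_solvable all_field all_character.
Set Implicit Arguments.
Unset Strict Implicit.
Unset Printing Implicit Defensive.
Import Order.TTheory GRing.Theory Num.Theory.
Local Open Scope ring_scope.

Section Digraphs.

Variable T : finType.

Definition is_tournament (V : {set T}) (E : {set T * T}) : bool :=
  [&& E \subset setX V V,
      [forall x in V, (x, x) \notin E]
    & [forall x in V, forall y in V,
         (x != y) ==> ((x, y) \in E) (+) ((y, x) \in E)]].

Definition is_transitive_tournament (V : {set T}) (E : {set T * T}) : bool :=
  is_tournament V E &&
  [exists a : #|V|.-tuple T, perm_eq a (enum V) &&
     [forall i : 'I_#|V|, forall j : 'I_#|V|,
        (i < j)%N ==> ((tnth a i, tnth a j) \in E)]].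

(* A subdigraph of a digraph e on T is a pair (vertex set, edge set), the
   edges being edges of e. *)
Definition num_transitive_subtournaments (m : nat) (e : rel T) : nat :=
  #|[set H : {set T} * {set T * T} |
      [&& is_transitive_tournament H.1 H.2, #|H.1| == m
        & [forall x, forall y, ((x, y) \in H.2) ==> e x y]]]|.

End Digraphs.

Definition kth_powers (F : finFieldType) (k : nat) : {set F} :=
  [set x ^+ k | x in F & x != 0].

Definition paley_digraph (F : finFieldType) (k : nat) : rel F :=
  fun a b => b - a \in kth_powers F k.

(* Multiplicative characters of F are the linear characters of the unit group
   of F. They take values in algC, which loses nothing: a complex-valued
   character of a finite group takes values in the roots of unity. Products,
   powers and inverses of characters are those of the ring 'CF(_), whose unit
   is the trivial character. *)
Notation mulcf F := 'CF([set: {unit F}]).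

Section Hypergeometric.

Variable F : finFieldType.
Implicit Types A B chi : mulcf F.

Definition ext0 A (x : F) : algC :=
  if insub x is Some u then A (u : {unit F}) else 0.

Definition jacobi_sum A B : algC := \sum_(a : F) ext0 A a * ext0 B (1 - a).

Definition char_binom A B : algC :=
  ext0 B (-1) / #|F|%:R * jacobi_sum A B^-1.

(* The tuples A and B hold the parameters A_1, ..., A_n and B_1, ..., B_n. *)
Definition greeneF n A0 (A B : n.-tuple (mulcf F)) (lambda : F) : algC :=
  #|F|%:R / (#|F|%:R - 1) *
  \sum_(i : Iirr [set: {unit F}] | 'chi_i \is a linear_char)
    char_binom (A0 * 'chi_i) 'chi_i *
    (\prod_(j < n) char_binom (tnth A j * 'chi_i) (tnth B j * 'chi_i)) *
    ext0 'chi_i lambda.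

(* The exponents t_1, ..., t_5, given as elements of 'Z_k, are read through their
   representatives in {0, ..., k - 1}; this is harmless when chi has order k, k
   is even and k > 1. *)
Definition greene3F2 (k : nat) chi (t : 5.-tuple 'Z_k) (lambda : F) : algC :=
  let e i : nat := nth 0 t i.-1 in
  (-1) ^+ (e 3 + e 5)%N *
  greeneF (chi ^+ e 1) [tuple chi ^+ e 2; chi ^+ e 3]
          [tuple chi ^+ e 4; chi ^+ e 5] lambda.

End Hypergeometric.

(* Main.v *)
Require Import Defs.
From mathcomp Require Import all_boot all_order all_algebra all_fingroup.
From mathcomp Require Import all_solvable all_field all_character.
From mathcomp Require Import ring zify.
Set Implicit Arguments.
Unset Strict Implicit.
Unset Printing Implicit Defensive.
Import Order.TTheory GRing.Theory Num.Theory.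
Local Open Scope ring_scope.

(** Write S for the group of nonzero k-th powers and s for its indicator. Both
    sides of the identity are multiples of
      N = #{(y, z) : y, z, y - 1, z - 1, z - y all in S}.

    Left-hand side. A transitive tournament has a unique transitive listing of
    its vertices, so the count is that of the 4-tuples (a, b, c, d) with all
    the forward differences in S [num_transitive_subtournamentsE]. Translating
    a to 0 and dividing by b, which lies in S, turns this number into q |S| N
    [num_transitive_subtournaments4_paley], and k |S| = q - 1.

    Right-hand side. Since B(-1) / B(1 - a) = 1 / B(a - 1), a binomial of
    characters is q^-1 sum_a A(a) / B(a - 1) [char_binomE]. Orthogonality of
    the characters chi in the sum defining 3F2 leaves q^-2 times a sum over
    the triples with
      a / (a - 1) * (b / (b - 1)) * (c / (c - 1)) = 1    [greene3F2_at1].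
    As chi_k(-1) = -1 [ext0_N1], the sign (-1)^(t3 + t5) replaces c and c - 1
    by -c and 1 - c. Each of the five sums over t_i is then k times a value of
    s [sum_ext0_exp_char], so that the sum over t is q^-2 k^5 times the number
    of such triples with a, b, b - 1, -c, 1 - c in S [sum_greene3F2]. With
    b = z and c = 1 - y, the equation reads a (z - y) = (z - 1) y
    [cross_ratio_eq1]: it determines a, which lies in S if and only if z - y
    does. Hence there are N triples [sum_triples_cross_count]. *)

(** * Transitive subtournaments as tuples *)

(** The edges of the transitive tournament listed by [a]: the pairs of an
    earlier and a later entry. *)
Definition chain_edges (T : finType) m (a : m.-tuple T) : {set T * T} :=
  [set p | [exists i : 'I_m, exists j : 'I_m,
              (i < j)%N && (p == (tnth a i, tnth a j))]].

Lemma chain_edgesP (T : finType) m (a : m.-tuple T) x y :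
  reflect (exists i j : 'I_m, [/\ (i < j)%N, x = tnth a i & y = tnth a j])
          ((x, y) \in chain_edges a).
Proof.
rewrite inE; apply: (iffP existsP) => [[i /existsP[j /andP[ij /eqP[-> ->]]]]|].
  by exists i, j.
by case=> i [j [ij -> ->]]; exists i; apply/existsP; exists j; rewrite ij /=.
Qed.

Lemma pairwise_tnthP (T : Type) m (r : rel T) (a : m.-tuple T) :
  reflect (forall i j : 'I_m, (i < j)%N -> r (tnth a i) (tnth a j))
          (pairwise r a).
Proof.
case: m a => [|m] a; first by rewrite tuple0; left; case.
have x0 : T := tnth a ord0.
apply: (iffP (pairwiseP x0)) => [H i j ij | H i j].
  by rewrite !(tnth_nth x0); apply: H; rewrite ?inE ?size_tuple.
rewrite !inE !size_tuple => im jm ij.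
by have := H (Ordinal im) (Ordinal jm) ij; rewrite !(tnth_nth x0).
Qed.

Lemma pairwise_irr_uniq (T : eqType) (e : rel T) (s : seq T) :
  irreflexive e -> pairwise e s -> uniq s.
Proof.
move=> eI; rewrite uniq_pairwise; apply: sub_pairwise => x y /= exy.
by apply: contraTneq exy => ->; rewrite eI.
Qed.

Lemma pairwise_chain_edges (T : finType) m (a : m.-tuple T) :
  pairwise (fun x y => (x, y) \in chain_edges a) a.
Proof. by apply/pairwise_tnthP => i j ij; apply/chain_edgesP; exists i, j. Qed.

Lemma chain_edges_asym (T : finType) m (a : m.-tuple T) x y : uniq a ->
  (x, y) \in chain_edges a -> (y, x) \notin chain_edges a.
Proof.
move=> /tuple_uniqP a_inj /chain_edgesP[i [j [ij -> ->]]].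
apply/chain_edgesP=> -[i' [j' [ij' /a_inj ei /a_inj ej]]].
by move: ij'; rewrite -ei -ej ltnNge ltnW.
Qed.

Lemma chain_edges_tournament (T : finType) m (a : m.-tuple T) : uniq a ->
  is_tournament [set x in a] (chain_edges a).
Proof.
move=> Ua; apply/and3P; split.
- apply/subsetP=> -[x y] /chain_edgesP[i [j [_ -> ->]]].
  by rewrite !inE !mem_tnth.
- apply/forall_inP=> x _; apply/negP=> xx.
  by have := chain_edges_asym Ua xx; rewrite xx.
apply/forall_inP=> x; rewrite inE => /tnthP[i ->].
apply/forall_inP=> y; rewrite inE => /tnthP[j ->].
apply/implyP=> nij.
wlog ij : i j nij / (i < j)%N.
  move=> W; case: (ltngtP i j) => [/W-> //|ji|ij].
    by rewrite addbC W // eq_sym.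
  by case/eqP: nij; congr tnth; apply: val_inj.
have E : (tnth a i, tnth a j) \in chain_edges a.
  by apply/chain_edgesP; exists i, j.
by rewrite E (negPf (chain_edges_asym Ua E)).
Qed.

(** A tournament that contains the forward edges of a listing of its vertices
    has no other edge. *)
Lemma tournament_chain_edges (T : finType) m (V : {set T}) (E : {set T * T})
    (a : m.-tuple T) :
  is_tournament V E -> V =i a -> pairwise (fun x y => (x, y) \in E) a ->
  E = chain_edges a.
Proof.
case/and3P=> /subsetP EV /forall_inP Eirr /forall_inP Etot Va /pairwise_tnthP Ea.
apply/setP=> -[x y]; apply/idP/chain_edgesP; last first.
  by case=> i [j [ij -> ->]]; apply: Ea.
move=> xy; have := EV _ xy; rewrite inE /= => /andP[Vx Vy].
have := Vx; rewrite Va => /tnthP[i xi]; have := Vy; rewrite Va => /tnthP[j yj].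
exists i, j; split=> //; rewrite ltnNge leq_eqVlt; apply/negP=> /orP[/eqP ji|ji].
  have exy : x = y by rewrite xi yj; congr tnth; apply: val_inj.
  by have := Eirr x Vx; rewrite {2}exy xy.
have yx : (y, x) \in E by rewrite xi yj Ea.
have /forall_inP/(_ y Vy) := Etot x Vx; rewrite xy yx /= implybF negbK => /eqP exy.
by have := Eirr x Vx; rewrite {2}exy xy.
Qed.

(** No antisymmetry of [e] is needed: a tournament carries its own edge set,
    so that both orientations of a pair are counted when both are edges. *)
Lemma num_transitive_subtournamentsE (T : finType) m (e : rel T) :
  irreflexive e ->
  num_transitive_subtournaments m e = #|[set a : m.-tuple T | pairwise e a]|.
Proof.
move=> eI; pose f (a : m.-tuple T) := ([set x in a], chain_edges a).
rewrite -(@card_in_imset _ _ f); last first.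
  move=> a b; rewrite !inE => /(pairwise_irr_uniq eI) Ua.
  move=> /(pairwise_irr_uniq eI) Ub [/setP Eab Cab]; apply: val_inj => /=.
  apply: (@pairwise_eq _ (fun x y => (x, y) \in chain_edges a)).
  - move=> x y /andP[xy yx].
    by have := chain_edges_asym Ua xy; rewrite yx.
  - exact: pairwise_chain_edges.
  - by rewrite Cab pairwise_chain_edges.
  by apply: uniq_perm => // x; have := Eab x; rewrite !inE.
congr #|pred_of_set _|; apply/setP=> -[V E]; rewrite inE /=.
apply/and3P/imsetP=> [[/andP[VE /existsP[a0 /andP[pa /forallP Ea]]] /eqP Vm Ee]|].
  pose b := tcast Vm a0; have ab : b = a0 :> seq T by rewrite val_tcast.
  have Va : V =i b.
    by move=> x; rewrite -[RHS]/(x \in tval b) ab (perm_mem pa) mem_enum.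
  have {}Ea : pairwise (fun x y => (x, y) \in E) b.
    rewrite ab; apply/pairwise_tnthP=> i j ij.
    by have /forallP/(_ j) := Ea i; rewrite ij.
  exists b.
    rewrite inE; apply: sub_pairwise Ea => x y xy.
    by have /forallP/(_ x)/forallP/(_ y) := Ee; rewrite xy.
  rewrite /f -(tournament_chain_edges VE Va Ea); congr pair.
  by apply/setP=> x; rewrite inE Va.
case=> a; rewrite inE => ea [-> ->]; have Ua := pairwise_irr_uniq eI ea.
have cV : #|[set x in a]| = m.
  by rewrite cardsE; move/card_uniqP: Ua ->; rewrite size_tuple.
split; last 1 first.
- apply/forallP=> x; apply/forallP=> y; apply/implyP=> /chain_edgesP[i [j [ij -> ->]]].
  by move/pairwise_tnthP: ea => ->.
- rewrite /is_transitive_tournament chain_edges_tournament //=.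
  apply/existsP; exists (tcast (esym cV) a); rewrite val_tcast.
  apply/andP; split.
    by apply: uniq_perm; rewrite ?enum_uniq // => x; rewrite mem_enum inE.
  apply/forallP=> i; apply/forallP=> j; apply/implyP=> ij.
  rewrite !tcastE; apply/chain_edgesP.
  by exists (cast_ord (esym (esym cV)) i), (cast_ord (esym (esym cV)) j).
by rewrite cV.
Qed.

(** * Characters extended by zero *)

Lemma field0_or_unit (F : finFieldType) (x : F) :
  x = 0 \/ exists u : {unit F}, x = val u.
Proof.
case: (eqVneq x 0) => [->|x0]; [by left | right].
by have Ux : x \is a GRing.unit; rewrite ?unitfE //; exists (FinRing.unit F Ux).
Qed.

Lemma ext0_val (F : finFieldType) (A : mulcf F) (u : {unit F}) :
  ext0 A (val u) = A u.
Proof. by rewrite /ext0 valK. Qed.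

Lemma ext0_0 (F : finFieldType) (A : mulcf F) : ext0 A 0 = 0.
Proof. by rewrite /ext0 insubF ?unitr0. Qed.

Lemma ext0_1 (F : finFieldType) (A : mulcf F) :
  A \is a linear_char -> ext0 A 1 = 1.
Proof. by move=> linA; rewrite -[1]/(val (1%g : {unit F})) ext0_val lin_char1. Qed.

Lemma ext0M (F : finFieldType) (A : mulcf F) (x y : F) :
  A \is a linear_char -> ext0 A (x * y) = ext0 A x * ext0 A y.
Proof.
move=> linA; have [->|[u ->]] := field0_or_unit x; first by rewrite mul0r ext0_0 mul0r.
have [->|[v ->]] := field0_or_unit y; first by rewrite mulr0 ext0_0 mulr0.
by rewrite -FinRing.val_unitM !ext0_val lin_charM ?inE.
Qed.

Lemma ext0V (F : finFieldType) (A : mulcf F) (x : F) :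
  A \is a linear_char -> ext0 A x^-1 = (ext0 A x)^-1.
Proof.
move=> linA; have [->|[u ->]] := field0_or_unit x; first by rewrite invr0 ext0_0 invr0.
by rewrite -FinRing.val_unitV !ext0_val lin_charV ?inE.
Qed.

Lemma ext0_neq0 (F : finFieldType) (A : mulcf F) (x : F) :
  A \is a linear_char -> x != 0 -> ext0 A x != 0.
Proof.
move=> linA; have [->|[u ->]] := field0_or_unit x; first by rewrite eqxx.
by rewrite ext0_val lin_char_neq0 ?inE.
Qed.

Lemma ext0_mul_char (F : finFieldType) (A B : mulcf F) (x : F) :
  ext0 (A * B) x = ext0 A x * ext0 B x.
Proof.
have [->|[u ->]] := field0_or_unit x; first by rewrite !ext0_0 mul0r.
by rewrite !ext0_val cfunE.
Qed.

Lemma ext0_inv_char (F : finFieldType) (A : mulcf F) (x : F) :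
  A \is a linear_char -> ext0 A^-1 x = (ext0 A x)^-1.
Proof.
move=> linA; have [->|[u ->]] := field0_or_unit x; first by rewrite !ext0_0 invr0.
rewrite !ext0_val invr_lin_char // cfunE /= -lin_charV_conj ?inE //.
by rewrite lin_charV ?inE.
Qed.

Lemma ext0_exp_char (F : finFieldType) (A : mulcf F) n (x : F) :
  x != 0 -> ext0 (A ^+ n) x = ext0 A x ^+ n.
Proof.
have [->|[u ->]] := field0_or_unit x; first by rewrite eqxx.
by move=> _; rewrite !ext0_val exp_cfunE ?inE.
Qed.

(** Second orthogonality relation, read off the regular character. The unit
    group being cyclic, the restriction to linear characters is no
    restriction. *)
Lemma sum_ext0_char (F : finFieldType) (x : F) :
  \sum_(i : Iirr [set: {unit F}] | 'chi_i \is a linear_char) ext0 'chi_i x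
    = (#|F|%:R - 1) * (x == 1)%:R.
Proof.
have cyc : cyclic [set: {unit F}] by exact: field_unit_group_cyclic.
have [->|[u ->]] := field0_or_unit x.
  rewrite eq_sym oner_eq0 mulr0 big1 // => i _; exact: ext0_0.
transitivity (cfReg [set: {unit F}] u).
  rewrite cfReg_sum sum_cfunE; apply: eq_big => [i|i _].
    by rewrite irr_cyclic_lin.
  by rewrite ext0_val cfunE lin_char1 ?mul1r ?irr_cyclic_lin.
rewrite cfRegE card_finField_unit -mulr_natr -FinRing.val_unit1 (inj_eq val_inj).
by rewrite -subn1 natrB // (cardD1 0).
Qed.

(** * Character binomials and 3F2 at 1 *)

Lemma char_binomE (F : finFieldType) (A B : mulcf F) :
  B \is a linear_char ->
  char_binom A B = #|F|%:R^-1 * \sum_(a : F) ext0 A a / ext0 B (a - 1).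
Proof.
move=> linB; rewrite /char_binom /jacobi_sum mulrAC mulrC mulr_sumr.
congr (_ * _); apply: eq_bigr => a _.
have B0 : ext0 B (-1) != 0 by rewrite ext0_neq0 // oppr_eq0 oner_eq0.
rewrite ext0_inv_char // -(opprB a 1) -[- (a - 1)]mulN1r ext0M // invfM.
by rewrite mulrCA mulVKf.
Qed.

Lemma mulr_sum3 (R : comPzRingType) (I : finType) (f g h : I -> R) :
  (\sum_a f a) * (\sum_b g b) * (\sum_c h c)
    = \sum_(p : I * I * I) f p.1.1 * g p.1.2 * h p.2.
Proof.
rewrite big_distrlr pair_bigA big_distrlr pair_bigA /=.
by apply: eq_bigr.
Qed.

(** When [p.1.1], [p.1.2] or [p.2] is 1, the ratio is 0 by the convention
    [0^-1 = 0], so that these degenerate triples contribute nothing. *)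
Lemma greene3F2_at1 (F : finFieldType) (A0 A1 A2 B1 B2 : mulcf F) :
  A0 \is a linear_char -> A1 \is a linear_char -> A2 \is a linear_char ->
  B1 \is a linear_char -> B2 \is a linear_char ->
  greeneF A0 [tuple A1; A2] [tuple B1; B2] 1
    = #|F|%:R ^- 2 * \sum_(p : F * F * F)
        ext0 A0 p.1.1 * (ext0 A1 p.1.2 / ext0 B1 (p.1.2 - 1))
          * (ext0 A2 p.2 / ext0 B2 (p.2 - 1))
          * (p.1.1 / (p.1.1 - 1) * (p.1.2 / (p.1.2 - 1)) * (p.2 / (p.2 - 1))
               == 1)%:R.
Proof.
move=> l0 l1 l2 m1 m2; rewrite /greeneF.
have q0 : #|F|%:R != 0 :> algC by rewrite pnatr_eq0 (cardD1 0).
have q1 : #|F|%:R - 1 != 0 :> algC.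
  by rewrite subr_eq0 pnatr_eq1 neq_ltn finNzRing_gt1 orbT.
transitivity (#|F|%:R / (#|F|%:R - 1) * \sum_(i : Iirr [set: {unit F}] |
    'chi_i \is a linear_char) #|F|%:R ^- 3 * \sum_(p : F * F * F)
        ext0 A0 p.1.1 * (ext0 A1 p.1.2 / ext0 B1 (p.1.2 - 1))
          * (ext0 A2 p.2 / ext0 B2 (p.2 - 1))
          * ext0 'chi_i
              (p.1.1 / (p.1.1 - 1) * (p.1.2 / (p.1.2 - 1)) * (p.2 / (p.2 - 1)))).
  congr (_ * _); apply: eq_bigr => i li.
  rewrite ext0_1 // mulr1 !big_ord_recl big_ord0 mulr1 /=.
  rewrite !(tnth_nth 0 [tuple _; _]) /= !char_binomE ?rpredM //.
  transitivity (#|F|%:R ^- 3 * ((\sum_a ext0 (A0 * 'chi_i) a / ext0 'chi_i (a - 1)) *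
    (\sum_a ext0 (A1 * 'chi_i) a / ext0 (B1 * 'chi_i) (a - 1)) *
    (\sum_a ext0 (A2 * 'chi_i) a / ext0 (B2 * 'chi_i) (a - 1)))).
    by field.
  rewrite mulr_sum3; congr (_ * _); apply: eq_bigr => -[[a b] c] _ /=.
  rewrite !ext0M // !ext0V // !ext0_mul_char !invfM; ring.
rewrite -mulr_sumr exchange_big /= mulrA.
have -> : #|F|%:R / (#|F|%:R - 1) / #|F|%:R ^+ 3 =
          #|F|%:R ^- 2 / (#|F|%:R - 1) :> algC by field; rewrite q0 q1.
rewrite -mulrA mulr_sumr; congr (_ * _); apply: eq_bigr => p _.
by rewrite -mulr_sumr sum_ext0_char mulrCA mulKf.
Qed.

(** * Sums over tuples *)

Lemma sum_tuple_prod (R : comPzRingType) (I : finType) n (f : 'I_n -> I -> R) :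
  \sum_(t : n.-tuple I) \prod_(i < n) f i (tnth t i)
    = \prod_(i < n) \sum_x f i x.
Proof.
rewrite bigA_distr_bigA (reindex (fun t : n.-tuple I => [ffun i => tnth t i])) /=.
  by apply: eq_bigr => t _; apply: eq_bigr => i _; rewrite ffunE.
exists (fun g : {ffun 'I_n -> I} => [tuple g i | i < n]) => [t|g] _.
  by apply: eq_from_tnth => i; rewrite tnth_mktuple ffunE.
by apply/ffunP=> i; rewrite ffunE tnth_mktuple.
Qed.

Lemma sum_tuple5 (R : comPzRingType) (I : finType) (x0 : I)
    (f1 f2 f3 f4 f5 : I -> R) :
  \sum_(t : 5.-tuple I) f1 (nth x0 t 0) * f2 (nth x0 t 1) * f3 (nth x0 t 2)
      * f4 (nth x0 t 3) * f5 (nth x0 t 4)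
  = (\sum_x f1 x) * (\sum_x f2 x) * (\sum_x f3 x) * (\sum_x f4 x)
      * (\sum_x f5 x).
Proof.
pose f (i : 'I_5) := nth f1 [:: f1; f2; f3; f4; f5] i.
transitivity (\prod_(i < 5) \sum_x f i x); last first.
  by rewrite !big_ord_recl big_ord0 /f /=; ring.
rewrite -sum_tuple_prod; apply: eq_bigr => t _.
rewrite !big_ord_recl big_ord0 /f /= !(tnth_nth x0) /=; ring.
Qed.

Lemma sum_tuple_cons (R : nmodType) (I : finType) n (f : n.+1.-tuple I -> R) :
  \sum_t f t = \sum_x \sum_(t : n.-tuple I) f [tuple of x :: t].
Proof.
rewrite pair_bigA (reindex (fun p : I * n.-tuple I => [tuple of p.1 :: p.2])) //.
exists (fun t : n.+1.-tuple I => (thead t, [tuple of behead t])) => [[x t]|t] _.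
  by congr pair; apply: val_inj.
by rewrite -tuple_eta.
Qed.

Lemma sum_tuple0 (R : nmodType) (I : finType) (f : 0.-tuple I -> R) :
  \sum_t f t = f [tuple].
Proof. by rewrite (big_pred1 [tuple]) // => t; apply/esym/eqP; apply: tuple0. Qed.

(** * Nonzero k-th powers *)

(** The indicator function of the nonzero k-th powers. *)
Definition kpow (F : finFieldType) k (x : F) : algC := (x \in kth_powers F k)%:R.

Lemma kth_powersP (F : finFieldType) k (x : F) :
  reflect (exists2 y, y != 0 & x = y ^+ k) (x \in kth_powers F k).
Proof.
by apply: (iffP imsetP) => -[y y0 ->]; exists y => //; move: y0; rewrite !inE.
Qed.

Lemma kth_powers_neq0 (F : finFieldType) k (x : F) : x \in kth_powers F k -> x != 0.
Proof. by case/kth_powersP=> y y0 ->; rewrite expf_neq0. Qed.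

Lemma kpow0 (F : finFieldType) k : kpow k (0 : F) = 0.
Proof.
by rewrite /kpow; case: (boolP (0 \in _)) => // /kth_powers_neq0; rewrite eqxx.
Qed.

Lemma kth_powersV (F : finFieldType) k (x : F) :
  (x^-1 \in kth_powers F k) = (x \in kth_powers F k).
Proof.
have H (y : F) : y \in kth_powers F k -> y^-1 \in kth_powers F k.
  case/kth_powersP=> z z0 ->; apply/kth_powersP.
  by exists z^-1; rewrite ?exprVn ?invr_eq0.
by apply/idP/idP => /H; rewrite ?invrK.
Qed.

Lemma kth_powersM (F : finFieldType) k (x y : F) :
  x \in kth_powers F k -> y \in kth_powers F k -> x * y \in kth_powers F k.
Proof.
case/kth_powersP=> z z0 -> /kth_powersP[w w0 ->]; apply/kth_powersP.
by exists (z * w); rewrite ?exprMn ?mulf_neq0.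
Qed.

Lemma kth_powersMl (F : finFieldType) k (x y : F) :
  x \in kth_powers F k -> (x * y \in kth_powers F k) = (y \in kth_powers F k).
Proof.
move=> Sx; apply/idP/idP => [Sxy|]; last exact: kth_powersM.
rewrite -(mulKf (kth_powers_neq0 Sx) y); apply: kth_powersM => //.
by rewrite kth_powersV.
Qed.

Lemma card_kth_powers (F : finFieldType) k :
  (k %| #|F|.-1)%N -> (k * #|kth_powers F k|)%N = #|F|.-1.
Proof.
move=> kq; have /cyclicP[g gE] := field_unit_group_cyclic [set: {unit F}]%G.
have og : #[g]%g = #|F|.-1 by rewrite orderE -gE card_finField_unit.
have -> : kth_powers F k = [set val u | u in <[g ^+ k]>%g].
  apply/setP=> x; apply/kth_powersP/imsetP=> [[y y0 ->]|[u + ->]].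
    have [/eqP|[u yu]] := field0_or_unit y; first by rewrite (negPf y0).
    have /cycleP[m um] : u \in <[g]>%g by rewrite -gE inE.
    exists ((g ^+ k) ^+ m)%g; first exact: mem_cycle.
    by rewrite yu um -FinRing.val_unitX -!expgM mulnC.
  case/cycleP=> m ->; exists (val (g ^+ m)%g).
    by rewrite -unitfE (valP (g ^+ m)%g).
  by rewrite -FinRing.val_unitX -!expgM mulnC.
rewrite card_imset; last exact: val_inj.
by rewrite -orderE orderXdiv ?og // mulnC divnK.
Qed.


(** The kernel of a character of order k is the group of k-th powers: on a
    generator g of the unit group, [chi (g ^+ m) = 1] forces [k %| m]. *)
Lemma ext0_eq1_kth_powers (F : finFieldType) (chi : mulcf F) k (x : F) :
  chi \is a linear_char -> #[chi]%CF = k -> x != 0 ->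
  (ext0 chi x == 1) = (x \in kth_powers F k).
Proof.
move=> linc oc x0; apply/eqP/kth_powersP=> [|[y y0 ->]]; last first.
  have [/eqP|[v ->]] := field0_or_unit y; first by rewrite (negPf y0).
  rewrite -FinRing.val_unitX ext0_val lin_charX ?inE //.
  by apply: (dvdn_cforderP (G := [set: {unit F}]%G)); rewrite ?oc ?inE.
have /cyclicP[g gE] := field_unit_group_cyclic [set: {unit F}]%G.
have [/eqP|[u ->]] := field0_or_unit x; first by rewrite (negPf x0).
have gP v : exists m, v = (g ^+ m)%g by apply/cycleP; rewrite -gE inE.
have [m ->] := gP u; rewrite ext0_val lin_charX ?inE // => gm1.
have : (k %| m)%N.
  rewrite -oc; apply/dvdn_cforderP=> v _; have [j ->] := gP v.
  by rewrite lin_charX ?inE // exprAC gm1 expr1n.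
case/dvdnP=> j ->; exists (val (g ^+ j)%g).
  by rewrite -unitfE (valP (g ^+ j)%g).
by rewrite -FinRing.val_unitX -expgM.
Qed.

Lemma sum_ext0_exp_char (F : finFieldType) (chi : mulcf F) k (x : F) :
  (1 < k)%N -> chi \is a linear_char -> #[chi]%CF = k ->
  \sum_(t : 'Z_k) ext0 (chi ^+ t) x = k%:R * kpow k x.
Proof.
move=> k1 linc oc; have [->|x0] := eqVneq x 0.
  by rewrite kpow0 mulr0 big1 // => t _; rewrite ext0_0.
transitivity (\sum_(0 <= t < k) ext0 chi x ^+ t).
  rewrite -[in RHS](Zp_cast k1) big_mkord.
  by apply: eq_bigr => t _; rewrite ext0_exp_char.
rewrite /kpow -(ext0_eq1_kth_powers linc oc x0) big_mkord.
case: eqP => [->|/eqP z1].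
  rewrite mulr1 (eq_bigr (fun=> 1)) => [|i _]; last exact: expr1n.
  by rewrite sumr_const card_ord.
have zk : ext0 chi x ^+ k = 1.
  by rewrite -(expr0 (ext0 chi x)) -!ext0_exp_char // expr0 -oc exp_cforder.
have /eqP := subrX1 (ext0 chi x) k.
by rewrite zk subrr eq_sym mulf_eq0 subr_eq0 (negPf z1) mulr0 => /eqP.
Qed.

Lemma sum_ext0_exp_charV (F : finFieldType) (chi : mulcf F) k (x : F) :
  (1 < k)%N -> chi \is a linear_char -> #[chi]%CF = k ->
  \sum_(t : 'Z_k) (ext0 (chi ^+ t) x)^-1 = k%:R * kpow k x.
Proof.
move=> k1 linc oc; rewrite /kpow -kth_powersV -/(kpow k _).
rewrite -(sum_ext0_exp_char _ k1 linc oc); apply: eq_bigr => t _.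
by rewrite ext0V // rpredX.
Qed.

(** The hypothesis on [#|F|] says that (q - 1) / k is odd. Were chi(-1) equal
    to 1, then -1 = x ^ k for some x, and 1 = x ^ (q - 1) = -1; but F has odd
    characteristic, the order q - 1 of its unit group being even. *)
Lemma ext0_N1 (F : finFieldType) (chi : mulcf F) k :
  ~~ odd k -> (1 < k)%N -> (#|F| = k + 1 %[mod 2 * k])%N ->
  chi \is a linear_char -> #[chi]%CF = k -> ext0 chi (-1) = -1.
Proof.
move=> ek k1 qmod linc oc.
have [m [om qm]] : exists m, odd m /\ #|F|.-1 = (k * m)%N.
  exists (#|F| %/ (2 * k)).*2.+1; split; first by rewrite /= odd_double.
  have := divn_eq #|F| (2 * k); rewrite qmod modn_small; last lia.
  by move: (_ %/ _)%N => j ->; rewrite -addnn; nia.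
have /eqP := ext0M (-1) (-1) linc.
rewrite mulrNN mulr1 ext0_1 // eq_sym -expr2 sqrf_eq1 => /orP[|/eqP //].
rewrite (ext0_eq1_kth_powers linc oc) ?oppr_eq0 ?oner_eq0 //.
case/kth_powersP=> x x0 xk.
have x1 : x ^+ #|F|.-1 = 1.
  have [/eqP|[u ->]] := field0_or_unit x; first by rewrite (negPf x0).
  by rewrite -card_finField_unit -FinRing.val_unitX expg_cardG ?inE.
have N11 : -1 = 1 :> F by rewrite -[RHS]x1 qm exprM -xk -signr_odd om.
(* in characteristic 2, an element of order 2 would be trivial *)
have [u _ ou] : {u | u \in [set: {unit F}] & #[u]%g = 2%N}.
  by apply: Cauchy; rewrite // card_finField_unit qm dvdn_mulr // dvdn2.
have /eqP : val u ^+ 2 = 1 by rewrite -FinRing.val_unitX -ou expg_order.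
rewrite sqrf_eq1 N11 orbb -FinRing.val_unit1 (inj_eq val_inj) => /eqP u1.
by move: ou; rewrite u1 order1.
Qed.

(** * Counting in the Paley digraph *)

Lemma paley_irreflexive (F : finFieldType) k : irreflexive (@paley_digraph F k).
Proof.
move=> x; rewrite /paley_digraph subrr.
by apply/negP=> /kth_powers_neq0; rewrite eqxx.
Qed.

(** The number, in [algC], of pairs (y, z) such that y, z, y - 1, z - 1 and
    z - y are all nonzero k-th powers. *)
Definition cross_count (F : finFieldType) k : algC :=
  \sum_(y : F) \sum_(z : F)
    kpow k y * kpow k z * kpow k (y - 1) * kpow k (z - 1) * kpow k (z - y).

Lemma sum_kpow (F : finFieldType) k :
  \sum_(x : F) kpow k x = #|kth_powers F k|%:R.
Proof.
rewrite -sum1_card natr_sum [RHS]big_mkcond; apply: eq_bigr => x _.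
by rewrite /kpow; case: ifP.
Qed.

Lemma num_transitive_subtournaments4_paley (F : finFieldType) k :
  (num_transitive_subtournaments 4 (@paley_digraph F k))%:R
    = #|F|%:R * #|kth_powers F k|%:R * cross_count F k.
Proof.
rewrite (num_transitive_subtournamentsE _ (@paley_irreflexive F k)).
pose s := @kpow F k.
transitivity (\sum_(a : F) \sum_b \sum_c \sum_d
  s (b - a) * s (c - a) * s (d - a) * s (c - b) * s (d - b) * s (d - c)).
  transitivity (\sum_(a : 4.-tuple F) (pairwise (@paley_digraph F k) a)%:R : algC).
    rewrite -sum1_card natr_sum big_mkcond; apply: eq_bigr => a _.
    by rewrite inE; case: ifP.
  rewrite sum_tuple_cons; apply: eq_bigr => a _.
  rewrite sum_tuple_cons; apply: eq_bigr => b _.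
  rewrite sum_tuple_cons; apply: eq_bigr => c _.
  rewrite sum_tuple_cons; apply: eq_bigr => d _.
  rewrite sum_tuple0 /= !andbT -!mulnb !natrM /s /kpow /paley_digraph; ring.
transitivity (\sum_(a : F) \sum_b \sum_c \sum_d
  s b * s c * s d * s (c - b) * s (d - b) * s (d - c)).
  apply: eq_bigr => a _.
  (* translate the first vertex to 0 *)
  have E x y : x + a - (y + a) = x - y by ring.
  rewrite (reindex_inj (addIr a)); apply: eq_bigr => b _.
  rewrite (reindex_inj (addIr a)); apply: eq_bigr => c _.
  rewrite (reindex_inj (addIr a)); apply: eq_bigr => d _ /=.
  by rewrite !addrK !E.
rewrite sumr_const -[LHS]mulr_natl -sum_kpow -[RHS]mulrA; congr (_ * _).
rewrite mulr_suml; apply: eq_bigr => b _.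
(* divide the two other vertices by b, a k-th power in every nonzero term *)
have [->|b0] := eqVneq b 0.
  rewrite kpow0 mul0r big1 // => c _; rewrite big1 // => d _.
  by rewrite {1}/s kpow0 !mul0r.
rewrite (reindex_inj (mulfI b0)) mulr_sumr; apply: eq_bigr => c _.
rewrite (reindex_inj (mulfI b0)) mulr_sumr; apply: eq_bigr => d _ /=.
rewrite -[X in b * c - X]mulr1 -[X in b * d - X]mulr1 -!mulrBr {}/s /kpow.
have [/kth_powersMl Sb|_] := boolP (b \in _); last by rewrite !mul0r.
by rewrite !Sb !mul1r; ring.
Qed.

(** * Summing the hypergeometric values *)

Lemma sum_greene3F2 (F : finFieldType) (chi : mulcf F) k :
  (1 < k)%N -> chi \is a linear_char -> #[chi]%CF = k ->
  ext0 chi (-1) = -1 ->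
  \sum_(t : 5.-tuple 'Z_k) greene3F2 chi t 1
    = #|F|%:R ^- 2 * k%:R ^+ 5 * \sum_(p : F * F * F)
        kpow k p.1.1 * (kpow k p.1.2 * kpow k (p.1.2 - 1))
        * (kpow k (- p.2) * kpow k (1 - p.2))
        * (p.1.1 / (p.1.1 - 1) * (p.1.2 / (p.1.2 - 1)) * (p.2 / (p.2 - 1))
             == 1)%:R.
Proof.
move=> k1 linc oc chiN1.
have linX n : chi ^+ n \is a linear_char by rewrite rpredX.
have chiN n x : ext0 (chi ^+ n) (- x) = (-1) ^+ n * ext0 (chi ^+ n) x.
  by rewrite -[- x]mulN1r ext0M // ext0_exp_char ?oppr_eq0 ?oner_eq0 // chiN1.
pose D (t : 'Z_k) := ext0 (chi ^+ t).
transitivity (\sum_(t : 5.-tuple 'Z_k) #|F|%:R ^- 2 * \sum_(p : F * F * F)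
    D (nth 0 t 0) p.1.1 * D (nth 0 t 1%N) p.1.2 * D (nth 0 t 2) (- p.2)
    * (D (nth 0 t 3) (p.1.2 - 1))^-1 * (D (nth 0 t 4) (1 - p.2))^-1
    * (p.1.1 / (p.1.1 - 1) * (p.1.2 / (p.1.2 - 1)) * (p.2 / (p.2 - 1))
             == 1)%:R).
  apply: eq_bigr => t _; rewrite /greene3F2 greene3F2_at1 // mulrCA.
  congr (_ * _); rewrite mulr_sumr; apply: eq_bigr => p _ /=.
  (* the sign is split between the third and the fifth factor *)
  rewrite /D -(opprB p.2 1) !chiN invfM invr_sign exprD; ring.
rewrite -[LHS]mulr_sumr exchange_big /= -[RHS]mulrA; congr (_ * _).
rewrite [RHS]mulr_sumr.
apply: eq_bigr => p _; rewrite -mulr_suml [RHS]mulrA; congr (_ * _).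
rewrite (sum_tuple5 0 (D^~ p.1.1) (D^~ p.1.2) (D^~ (- p.2))
  (fun t => (D t (p.1.2 - 1))^-1) (fun t => (D t (1 - p.2))^-1)).
rewrite !(sum_ext0_exp_char _ k1 linc oc) !(sum_ext0_exp_charV _ k1 linc oc).
ring.
Qed.

(** The case [a = 1] is included: both sides are then false, the left one
    because [0^-1 = 0]. *)
Lemma cross_ratio_eq1 (F : fieldType) (a y z : F) :
  y != 0 -> z != 0 -> y - 1 != 0 -> z - 1 != 0 ->
  (a / (a - 1) * (z / (z - 1)) * ((1 - y) / (1 - y - 1)) == 1)
    = (a * (z - y) == (z - 1) * y).
Proof.
move=> y0 z0 y1 z1; have [->|a1] := eqVneq a 1.
  rewrite subrr invr0 mulr0 !mul0r eq_sym oner_eq0 -subr_eq0.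
  have -> : 1 * (z - y) - (z - 1) * y = - (z * (y - 1)) by ring.
  by rewrite oppr_eq0 mulf_eq0 (negPf z0) (negPf y1).
have {}a1 : a - 1 != 0 by rewrite subr_eq0.
rewrite -subr_eq0 -[RHS]subr_eq0.
have -> : a / (a - 1) * (z / (z - 1)) * ((1 - y) / (1 - y - 1)) - 1
    = - (a * (z - y) - (z - 1) * y) / ((a - 1) * (z - 1) * y).
  have y2 : 1 - y - 1 != 0 by rewrite addrAC subrr sub0r oppr_eq0.
  by field; rewrite a1 z1 y0 y2.
by rewrite mulf_eq0 oppr_eq0 invr_eq0 !mulf_eq0 (negPf a1) (negPf z1) (negPf y0) !orbF.
Qed.

(** When y, z, y - 1, z - 1 are k-th powers, the only a that can contribute is
    (z - 1) y / (z - y), which is a k-th power exactly when z - y is one; if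
    z = y, no a satisfies the equation. *)
Lemma sum_cross_ratio (F : finFieldType) k (y z : F) :
  \sum_(a : F) kpow k a * (kpow k z * kpow k (z - 1))
      * (kpow k (- (1 - y)) * kpow k (1 - (1 - y)))
      * (a / (a - 1) * (z / (z - 1)) * ((1 - y) / (1 - y - 1)) == 1)%:R
  = kpow k y * kpow k z * kpow k (y - 1) * kpow k (z - 1) * kpow k (z - y).
Proof.
rewrite subKr opprB.
have kpow1 x : x \in kth_powers F k -> kpow k x = 1 by rewrite /kpow => ->.
have kpowN x : x \notin kth_powers F k -> kpow k x = 0.
  by rewrite /kpow => /negPf->.
have [Sy|/kpowN->] := boolP (y \in kth_powers F k); last first.
  by rewrite !(mul0r, mulr0) big1 // => a _; rewrite !(mul0r, mulr0).
have [Sz|/kpowN->] := boolP (z \in kth_powers F k); last first.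
  by rewrite !(mul0r, mulr0) big1 // => a _; rewrite !(mul0r, mulr0).
have [Sy1|/kpowN->] := boolP (y - 1 \in kth_powers F k); last first.
  by rewrite !(mul0r, mulr0) big1 // => a _; rewrite !(mul0r, mulr0).
have [Sz1|/kpowN->] := boolP (z - 1 \in kth_powers F k); last first.
  by rewrite !(mul0r, mulr0) big1 // => a _; rewrite !(mul0r, mulr0).
have [y0 z0] := (kth_powers_neq0 Sy, kth_powers_neq0 Sz).
have [y1 z1] := (kth_powers_neq0 Sy1, kth_powers_neq0 Sz1).
rewrite (kpow1 _ Sy) (kpow1 _ Sz) (kpow1 _ Sy1) (kpow1 _ Sz1) !mulr1 mul1r.
under eq_bigr do rewrite !mulr1.
have [zy|zy] := eqVneq z y.
  rewrite -zy subrr kpow0 big1 // => a _.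
  rewrite cross_ratio_eq1 // subrr mulr0 eq_sym mulf_eq0 (negPf z1) (negPf z0).
  by rewrite mulr0.
have {}zy : z - y != 0 by rewrite subr_eq0.
rewrite (bigD1 ((z - 1) * y / (z - y))) //= big1 => [|a na]; last first.
  rewrite cross_ratio_eq1 // -(inj_eq (mulIf (invr_neq0 zy))) mulfK //.
  by rewrite (negPf na) mulr0.
rewrite addr0 cross_ratio_eq1 // mulfVK // eqxx !mulr1 -mulrA.
by rewrite /kpow !kth_powersMl // kth_powersV.
Qed.

Lemma sum_triples_cross_count (F : finFieldType) k :
  \sum_(p : F * F * F)
        kpow k p.1.1 * (kpow k p.1.2 * kpow k (p.1.2 - 1))
        * (kpow k (- p.2) * kpow k (1 - p.2))
        * (p.1.1 / (p.1.1 - 1) * (p.1.2 / (p.1.2 - 1)) * (p.2 / (p.2 - 1))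
             == 1)%:R
  = cross_count F k.
Proof.
pose G (p : F * F * F) : algC :=
  kpow k p.1.1 * (kpow k p.1.2 * kpow k (p.1.2 - 1))
  * (kpow k (- p.2) * kpow k (1 - p.2))
  * (p.1.1 / (p.1.1 - 1) * (p.1.2 / (p.1.2 - 1)) * (p.2 / (p.2 - 1)) == 1)%:R.
transitivity (\sum_u \sum_c G (u, c)).
  by rewrite pair_bigA; apply: eq_bigr => -[].
rewrite exchange_big (reindex_inj (can_inj (subKr 1))).
apply: eq_bigr => y _ /=.
transitivity (\sum_a \sum_z G (a, z, 1 - y)).
  by rewrite pair_bigA; apply: eq_bigr => -[].
by rewrite exchange_big; apply: eq_bigr => z _; apply: sum_cross_ratio.
Qed.

Theorem theorem2p1 (k q : nat) (F : finFieldType) (chi_k : mulcf F)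
    (k_ge2 : (2 <= k)%N) (k_even : ~~ odd k)
    (cardF : #|F| = q) (q_mod : (q = k + 1 %[mod 2 * k])%N)
    (chi_lin : chi_k \is a linear_char) (chi_order : #[chi_k]%CF = k) :
  (num_transitive_subtournaments 4 (@paley_digraph F k))%:R =
    (q%:R ^+ 3 * (q%:R - 1)) / k%:R ^+ 6 *
    \sum_(t : 5.-tuple 'Z_k) greene3F2 chi_k t 1 :> algC.
Proof.
rewrite -cardF in q_mod *.
have chiN1 : ext0 chi_k (-1) = -1 by apply: (@ext0_N1 _ _ k).
rewrite sum_greene3F2 // sum_triples_cross_count.
rewrite num_transitive_subtournaments4_paley.
have /card_kth_powers/(congr1 (fun n => n%:R : algC)) : (k %| #|F|.-1)%N.
  by rewrite -chi_order -card_finField_unit cforder_lin_char_dvdG.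
have q_gt0 : (0 < #|F|)%N by rewrite (cardD1 0).
rewrite natrM -subn1 natrB // => <-.
have q0 : #|F|%:R != 0 :> algC by rewrite pnatr_eq0 (cardD1 0).
have k0 : k%:R != 0 :> algC by rewrite pnatr_eq0 -lt0n ltnW.
by field; rewrite q0 k0.
Qed.
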